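(* Let $K$ be a field of characteristic $0$ and $m\ge1$. For $i=0,1,\dots,m+1$ let $E_i\in B_{m+1}^{m+1}(m)$ be the element $$E_i=(I_i\otimes A_{p}\otimes I_{p})\circ(\Sigma_{+1}(m+1)\otimes X_{p,p})\circ(I_i\otimes U_{p}\otimes I_{p}),\qquad p=m+1-i,$$ where $\Sigma_{+1}(m+1)=\sum_{\sigma\in\mathrm{Sym}_{m+1}}(-1)^{|\sigma|}\sigma$. Let $min_i=\min(i,m+1-i)$. Then $$E_i=\sum_{j=0}^{min_i}(-1)^jc_i(j)\,\Xi_i(j)\quad\text{with}\quad \Xi_i(j)=F_i\,e_i(j)\,F_i,\qquad c_i(j)=\big((i-j)!\,(m+1-i-j)!\,(j!)^2\big)^{-1}.$$
   Context: Brauer diagrams. For $k,\ell\in\mathbb{N}$, a $(k,\ell)$ Brauer diagram is a partition into pairs (arcs) of $k$ lower nodes and $\ell$ upper nodes (each row numbered left to right). $B_k^\ell(\delta)$ is the $K$-vector space with basis the $(k,\ell)$ diagrams. Composition $\circ$ (also written as product) is bilinear with $D_1\circ D_2=\delta^fD$, obtained by placing $D_1$ above $D_2$, identifying middle nodes and deleting the $f$ closed loops; $D\otimes D'$ is juxtaposition with $D'$ on the right. $B_r^r(\delta)$ is the Brauer algebra of degree $r$; here $\delta=m$. $I_q$ is the identity $(q,q)$ diagram (lower $i$ joined to upper $i$); $A_q$ is the $(2q,0)$ diagram joining $i$ with $2q+1-i$ for $1\le i\le q$; $U_q$ is the $(0,2q)$ diagram joining $i$ with $2q+1-i$; $X_{s,t}$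 is the $(s+t,s+t)$ diagram joining lower $i$ to upper $t+i$ ($1\le i\le s$) and lower $s+j$ to upper $j$ ($1\le j\le t$). $K\mathrm{Sym}_r\subset B_r^r(\delta)$ via permutation diagrams. For integers $1\le k<l$, $A(k,l)=\sum_{\sigma}(-1)^{|\sigma|}\sigma$, the sum over the symmetric group of $\{k,k+1,\dots,l\}$ (regarded in $\mathrm{Sym}_{m+1}$), and $A(k,l)=1$ if $k\ge l$. For $p=0,\dots,m+1$, $F_p=A(1,p)A(p+1,m+1)$ (so $F_0=A(1,m+1)$). For $a<b$, $e_{a,b}\in B_{m+1}^{m+1}(m)$ is the diagram joining lower $a$ to lower $b$, upper $a$ to upper $b$, and lower $c$ to upper $c$ for all other $c$. $e_i(j)=e_{i,i+1}e_{i-1,i+2}\cdots e_{i-j+1,i+j}$, with $e_i(0)=1$. *)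

(* Defs.v *)
From HB Require Import structures.
From mathcomp Require Import all_boot all_order all_fingroup all_algebra.
From mathcomp Require Import zify.

Set Implicit Arguments.
Unset Strict Implicit.
Unset Printing Implicit Defensive.

Import GRing.Theory.
Local Open Scope ring_scope.

(* A partition of a finite set into pairs is encoded as the fixed-point-free
   involution exchanging the two nodes of every arc.  In ['I_k + 'I_l], [inl]
   are the lower nodes and [inr] the upper ones, numbered from 0. *)
Definition matching (T : finType) (f : {ffun T -> T}) : bool :=
  [forall x, (f x != x) && (f (f x) == x)].

Record bdiag (k l : nat) := BDiag {
  bd_ffun : {ffun 'I_k + 'I_l -> 'I_k + 'I_l};
  bd_matching : matching bd_ffun }.

HB.instance Definition _ k l := [isSub for @bd_ffun k l].
HB.instance Definition _ k l := [Finite of bdiag k l by <:].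

Definition bd_fun k l (D : bdiag k l) (x : 'I_k + 'I_l) : 'I_k + 'I_l :=
  bd_ffun D x.
Coercion bd_fun : bdiag >-> Funclass.

Lemma bd_neq k l (D : bdiag k l) x : D x != x.
Proof. by have /forallP/(_ x)/andP[] := bd_matching D. Qed.

Lemma bdK k l (D : bdiag k l) : involutive D.
Proof. by move=> x; have /forallP/(_ x)/andP[_ /eqP] := bd_matching D. Qed.

Lemma matching_finfun (T : finType) (f : T -> T) :
  (forall x, f x != x) -> involutive f -> matching (finfun f).
Proof. by move=> f_neq fK; apply/forallP=> x; rewrite !ffunE f_neq fK eqxx. Qed.

Definition mk_bdiag k l (f : 'I_k + 'I_l -> 'I_k + 'I_l)
    (f_neq : forall x, f x != x) (fK : involutive f) : bdiag k l :=
  BDiag (matching_finfun f_neq fK).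

Lemma mk_bdiagE k l f f_neq fK x : @mk_bdiag k l f f_neq fK x = f x.
Proof. by rewrite /bd_fun ffunE. Qed.

(* Vertical composition of diagrams: [D1 : bdiag l n] above [D2 : bdiag k l].
   The glued graph has lower nodes ['I_k], middle nodes ['I_l] and upper nodes
   ['I_n]; its edges are the arcs of D2 ([arc_dn]) and those of D1
   ([arc_up]), each extended by the identity on the nodes it does not see. *)
Section DiagramComposition.
Variables (k l n : nat) (D1 : bdiag l n) (D2 : bdiag k l).

Let gnode : finType := ('I_k + 'I_l + 'I_n)%type.

Definition of_up (x : 'I_l + 'I_n) : gnode :=
  match x with inl j => inl (inr j) | inr u => inr u end.

Definition outer (x : 'I_k + 'I_n) : gnode :=
  match x with inl d => inl (inl d) | inr u => inr u end.

Definition arc_dn (v : gnode) : gnode :=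
  match v with inl x => inl (D2 x) | inr u => inr u end.

Definition arc_up (v : gnode) : gnode :=
  match v with
  | inl (inl d) => inl (inl d)
  | inl (inr j) => of_up (D1 (inl j))
  | inr u => of_up (D1 (inr u))
  end.

Definition glue : rel gnode := [rel v w | (w == arc_dn v) || (w == arc_up v)].

Definition bd_loops : nat :=
  n_comp glue [pred v | [forall x, ~~ connect glue v (outer x)]].

Definition bd_comp_fun (x : 'I_k + 'I_n) : 'I_k + 'I_n :=
  odflt x [pick y | (y != x) && connect glue (outer x) (outer y)].

Lemma arc_dnK : involutive arc_dn.
Proof. by case=> [x|u] //=; rewrite bdK. Qed.

Lemma arc_up_of_up y : arc_up (of_up y) = of_up (D1 y).
Proof. by case: y. Qed.

Lemma arc_upK : involutive arc_up.
Proof.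
case=> [[d|j]|u] //.
- by rewrite [arc_up (inl (inr j))]/= arc_up_of_up bdK.
- by rewrite [arc_up (inr u)]/= arc_up_of_up bdK.
Qed.

Lemma arc_dn_fix v : (arc_dn v == v) = (if v is inr _ then true else false).
Proof. by case: v => [x|u] /=; [exact/negbTE/(bd_neq D2 x) | rewrite eqxx]. Qed.

Lemma of_up_inj : injective of_up.
Proof. by move=> [a|a] [b|b] //= [->]. Qed.

Lemma outer_inj : injective outer.
Proof. by move=> [a|a] [b|b] //= [->]. Qed.

Lemma arc_up_fix v :
  (arc_up v == v) = (if v is inl (inl _) then true else false).
Proof.
case: v => [[d|j]|u] /=; first exact: eqxx.
- by rewrite (inj_eq of_up_inj (D1 (inl j)) (inl j)) (negbTE (bd_neq D1 _)).
- by rewrite (inj_eq of_up_inj (D1 (inr u)) (inr u)) (negbTE (bd_neq D1 _)).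
Qed.

Lemma glue_sym : symmetric glue.
Proof.
move=> v w /=.
by congr (_ || _); apply/eqP/eqP=> ->; rewrite ?arc_dnK ?arc_upK.
Qed.

Lemma glue_connect_sym : connect_sym glue.
Proof. exact/sym_connect_sym/glue_sym. Qed.

End DiagramComposition.

(* In the graph of two involutions without common fixed point, the component
   of a fixed point contains exactly one other fixed point. *)
Section TwoInvolutions.
Variables (T : finType) (a b : T -> T).
Hypotheses (aK : involutive a) (bK : involutive b).
Hypothesis ab_fix : forall x, ~~ ((a x == x) && (b x == x)).

Definition inv2_rel : rel T := [rel v w | (w == a v) || (w == b v)].

Lemma inv2_other x : a x = x ->
  exists2 y, [/\ y != x, connect inv2_rel x y & (a y == y) || (b y == y)] &
    forall z, z != x -> connect inv2_rel x z -> (a z == z) || (b z == z) ->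
      z = y.
Proof.
move=> ax; pose g z := b (a z).
have g_inj : injective g by apply: inj_comp; apply: can_inj; eassumption.
pose N := fingraph.order g x.
have itN : iter N g x = x := fingraph.iter_order g_inj x.
have it_inj i : injective (iter i g).
  by elim: i => [|i IHi] y z //= /g_inj /IHi.
have gai i : iter i g (a (iter i g x)) = x.
  elim: i => [|i IHi]; first exact: ax.
  by rewrite iterSr /= {2}/g /g aK bK.
have a_it i : (i <= N)%N -> a (iter i g x) = iter (N - i) g x.
  by move=> le_iN; apply: (it_inj i); rewrite gai -iterD subnKC.
have b_it i : (i <= N)%N -> b (iter i g x) = iter (N - i).+1 g x.
  by move=> le_iN; rewrite iterS -a_it // /g aK.
have it_eq i j : (i < N)%N -> (j < N)%N ->
    (iter i g x == iter j g x) = (i == j).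
  move=> ltiN ltjN; apply/eqP/eqP=> [eq_ij|-> //].
  by rewrite -(findex_iter ltiN) eq_ij findex_iter.
have N_gt1 : (1 < N)%N.
  have := fingraph.order_gt0 g x; rewrite -/N leq_eqVlt => /orP[/eqP N1|//].
  have := ab_fix x; rewrite ax eqxx /=.
  by move: itN; rewrite -N1 /= /g ax => ->; rewrite eqxx.
have orb z : connect inv2_rel x z -> exists2 i, (i < N)%N & z = iter i g x.
  have cl v : fconnect g x v -> fconnect g x (a v) /\ fconnect g x (b v).
    move=> xv; have lt_iN := findex_max xv.
    rewrite -(iter_findex xv) a_it ?b_it 1?ltnW //.
    by split; apply: fconnect_iter.
  have xz_or v z' : fconnect g x v -> connect inv2_rel v z' -> fconnect g x z'.
    move=> xv /connectP[p + ->]; elim: p v xv => [|w p IHp] v xv //=.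
    case/andP=> vw; apply: IHp.
    by have [? ?] := cl v xv; case/orP: vw => /eqP->.
  move=> /(xz_or _ _ (connect0 _ x)) xz.
  by exists (findex g x z); rewrite ?findex_max ?iter_findex.
have itc i : connect inv2_rel x (iter i g x).
  elim: i => [|i IHi] //=; apply: connect_trans IHi _.
  apply: (@connect_trans _ _ (a (iter i g x))).
    by apply: connect1; rewrite /inv2_rel /= eqxx.
  by apply: connect1; rewrite /inv2_rel /= eqxx orbT.
exists (iter (uphalf N) g x).
  split; [ | exact: itc | ].
  - by rewrite (it_eq _ 0%N); lia.
  - rewrite a_it ?b_it; try lia.
    have [No|Ne] := boolP (odd N).
      by rewrite (it_eq (N - uphalf N).+1); lia.
    by rewrite it_eq; lia.
move=> z zx /orb[i lt_iN z_i]; rewrite {}z_i in zx *.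
have i_gt0 : (0 < i)%N by move: zx; rewrite (it_eq i 0%N); lia.
rewrite a_it ?b_it 1?ltnW // => Hfix.
suff -> : i = uphalf N by [].
have [i1|i_neq1] := eqVneq i 1%N; last first.
  by move: Hfix; rewrite !it_eq; lia.
move: Hfix; rewrite i1 subn1 prednK; last lia.
by rewrite itN it_eq ?(it_eq 0%N); lia.
Qed.

End TwoInvolutions.

Section DiagramCompositionTheory.
Variables (k l n : nat) (D1 : bdiag l n) (D2 : bdiag k l).

Local Notation glue := (glue D1 D2).

Lemma outer_fix (x : 'I_k + 'I_n) :
  (arc_dn D2 (outer l x) == outer l x) || (arc_up D1 (outer l x) == outer l x).
Proof. by rewrite arc_dn_fix arc_up_fix; case: x. Qed.

Lemma glue_other x :
  exists2 y, (y != x) && connect glue (outer l x) (outer l y) &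
    forall z, z != x -> connect glue (outer l x) (outer l z) -> z = y.
Proof.
set a := arc_dn (n := n) D2; set b := arc_up (k := k) D1.
have aK : involutive a := @arc_dnK k l n D2.
have bK : involutive b := @arc_upK k l n D1.
have fixE v : (a v == v) || (b v == v) -> exists y, v = outer l y.
  rewrite arc_dn_fix arc_up_fix.
  by case: v => [[d|j]|u] //= _; [exists (inl d) | exists (inr u)].
have nfix v : ~~ ((a v == v) && (b v == v)).
  by rewrite arc_dn_fix arc_up_fix; case: v.
have nfix' v : ~~ ((b v == v) && (a v == v)) by rewrite andbC.
have eq_rel : inv2_rel b a =2 glue by move=> v w; apply: orbC.
case/orP: (outer_fix x) => /eqP fx.
- have [v [vx xv /fixE[y v_y]] v_uniq] := inv2_other aK bK nfix fx.
  rewrite v_y in vx xv v_uniq.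
  exists y; first by rewrite -(inj_eq (@outer_inj k l n)) vx.
  move=> z zx xz; apply: (@outer_inj k l n); apply: v_uniq => //.
    by rewrite (inj_eq (@outer_inj k l n)).
  exact: outer_fix.
- have [v [vx xv + ] v_uniq] := inv2_other bK aK nfix' fx.
  rewrite orbC => /fixE[y v_y]; rewrite v_y in vx xv v_uniq.
  exists y; first by rewrite -(inj_eq (@outer_inj k l n)) vx -(eq_connect eq_rel).
  move=> z zx xz; apply: (@outer_inj k l n); apply: v_uniq => //.
  - by rewrite (inj_eq (@outer_inj k l n)).
  - by rewrite (eq_connect eq_rel).
  - by rewrite orbC; apply: outer_fix.
Qed.

Lemma bd_comp_funP x y :
  bd_comp_fun D1 D2 x = y <->
  (y != x) && connect glue (outer l x) (outer l y).
Proof.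
have [y0 y0P y0_uniq] := glue_other x.
rewrite /bd_comp_fun; case: pickP => [z zP|/(_ y0)]; last by rewrite y0P.
case/andP: (zP) => zx xz /=.
split=> [<- //|/andP[yx xy]].
by rewrite (y0_uniq z) // (y0_uniq y).
Qed.

Lemma bd_comp_fun_neq x : bd_comp_fun D1 D2 x != x.
Proof. by have /bd_comp_funP/andP[] := erefl (bd_comp_fun D1 D2 x). Qed.

Lemma bd_comp_funK : involutive (bd_comp_fun D1 D2).
Proof.
move=> x; apply/bd_comp_funP; rewrite eq_sym glue_connect_sym.
exact/bd_comp_funP.
Qed.

Definition bd_comp : bdiag k n := mk_bdiag bd_comp_fun_neq bd_comp_funK.

End DiagramCompositionTheory.

(* Juxtaposition, with D' on the right of D. *)
Section DiagramTensor.
Variables (k l k' l' : nat) (D : bdiag k l) (D' : bdiag k' l').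

Definition bd_left (x : 'I_k + 'I_l) : 'I_(k + k') + 'I_(l + l') :=
  match x with inl i => inl (lshift k' i) | inr i => inr (lshift l' i) end.

Definition bd_right (x : 'I_k' + 'I_l') : 'I_(k + k') + 'I_(l + l') :=
  match x with inl i => inl (rshift k i) | inr i => inr (rshift l i) end.

Definition bd_tens_fun (x : 'I_(k + k') + 'I_(l + l')) :=
  match x with
  | inl i => match split i with
             | inl j => bd_left (D (inl j))
             | inr j => bd_right (D' (inl j))
             end
  | inr i => match split i with
             | inl j => bd_left (D (inr j))
             | inr j => bd_right (D' (inr j))
             end
  end.

Lemma bd_tens_left x : bd_tens_fun (bd_left x) = bd_left (D x).
Proof.
by case: x => i /=; rewrite -[lshift _ i]/(unsplit (inl i)) unsplitK.
Qed.

Lemma bd_tens_right x : bd_tens_fun (bd_right x) = bd_right (D' x).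
Proof.
by case: x => i /=; rewrite -[rshift _ i]/(unsplit (inr i)) unsplitK.
Qed.

Lemma bd_left_inj : injective bd_left.
Proof. by move=> [i|i] [j|j] //= [] /val_inj ->. Qed.

Lemma bd_right_inj : injective bd_right.
Proof. by move=> [i|i] [j|j] //= [] /addnI/val_inj ->. Qed.

Lemma bd_tens_cases x :
  (exists y, x = bd_left y) \/ (exists y, x = bd_right y).
Proof.
case: x => i; rewrite -(splitK i); case: (split i) => j /=.
- by left; exists (inl j).
- by right; exists (inl j).
- by left; exists (inr j).
- by right; exists (inr j).
Qed.

Lemma bd_tens_fun_neq x : bd_tens_fun x != x.
Proof.
case: (bd_tens_cases x) => -[y ->]; rewrite (bd_tens_left, bd_tens_right).
- by rewrite (inj_eq bd_left_inj) bd_neq.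
- by rewrite (inj_eq bd_right_inj) bd_neq.
Qed.

Lemma bd_tens_funK : involutive bd_tens_fun.
Proof.
move=> x; case: (bd_tens_cases x) => -[y ->].
- by rewrite !bd_tens_left bdK.
- by rewrite !bd_tens_right bdK.
Qed.

Definition bd_tens : bdiag (k + k') (l + l') :=
  mk_bdiag bd_tens_fun_neq bd_tens_funK.

End DiagramTensor.

(* Diagrams joining lower i to upper [f i], for a bijection f. *)
Section ThroughDiagram.
Variables (k l : nat) (f : 'I_k -> 'I_l) (g : 'I_l -> 'I_k).
Hypotheses (fK : cancel f g) (gK : cancel g f).

Definition bd_through_fun (x : 'I_k + 'I_l) : 'I_k + 'I_l :=
  match x with inl i => inr (f i) | inr j => inl (g j) end.

Lemma bd_through_neq x : bd_through_fun x != x.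
Proof. by case: x. Qed.

Lemma bd_throughK : involutive bd_through_fun.
Proof. by case=> i /=; rewrite ?fK ?gK. Qed.

Definition bd_through : bdiag k l := mk_bdiag bd_through_neq bd_throughK.

End ThroughDiagram.

Definition bd_id q : bdiag q q :=
  @bd_through q q id id (fun=> erefl) (fun=> erefl).

Definition bd_perm r (s : 'S_r) : bdiag r r := bd_through (permK s) (permKV s).

(* The s left strands pass to the right of the t right ones; ['I_(t + s)] is
   the row of s + t upper nodes. *)
Definition swap_ord s t (i : 'I_(s + t)) : 'I_(t + s) :=
  match split i with inl a => rshift t a | inr b => lshift s b end.

Lemma swap_ordK s t : cancel (@swap_ord s t) (@swap_ord t s).
Proof.
move=> i; rewrite -[RHS](splitK i) {2}/swap_ord; case: (split i) => j.
- by rewrite /swap_ord -[rshift _ j]/(unsplit (inr j)) unsplitK.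
- by rewrite /swap_ord -[lshift _ j]/(unsplit (inl j)) unsplitK.
Qed.

Definition bd_swap s t : bdiag (s + t) (t + s) :=
  bd_through (@swap_ordK s t) (@swap_ordK t s).

(* [rev_ord i] is 2q - 1 - i, that is 2q + 1 - i when numbering from 1. *)
Definition rev_sum k l (x : 'I_k + 'I_l) : 'I_k + 'I_l :=
  match x with inl i => inl (rev_ord i) | inr j => inr (rev_ord j) end.

Lemma rev_sumK k l : involutive (@rev_sum k l).
Proof. by case=> i /=; rewrite rev_ordK. Qed.

Lemma rev_ord_double_neq q (i : 'I_q.*2) : rev_ord i != i.
Proof. by apply/eqP=> /(congr1 val) /=; have := ltn_ord i; lia. Qed.

Lemma cap_neq q (x : 'I_q.*2 + 'I_0) : rev_sum x != x.
Proof. by case: x => [i|[]//]; apply: rev_ord_double_neq. Qed.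

Lemma cup_neq q (x : 'I_0 + 'I_q.*2) : rev_sum x != x.
Proof. by case: x => [[]//|i]; apply: rev_ord_double_neq. Qed.

Definition bd_cap q : bdiag q.*2 0 := mk_bdiag (@cap_neq q) (@rev_sumK q.*2 0).
Definition bd_cup q : bdiag 0 q.*2 := mk_bdiag (@cup_neq q) (@rev_sumK 0 q.*2).

(* [tperm a b] moves exactly a and b, when they are distinct; for a = b this
   is the identity diagram, a case which is never used. *)
Definition hook_fun r (a b : 'I_r) (x : 'I_r + 'I_r) : 'I_r + 'I_r :=
  match x with
  | inl c => if tperm a b c == c then inr c else inl (tperm a b c)
  | inr c => if tperm a b c == c then inl c else inr (tperm a b c)
  end.

Lemma hook_neq r (a b : 'I_r) x : hook_fun a b x != x.
Proof. by case: x => c /=; case: ifPn. Qed.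

Lemma hookK r (a b : 'I_r) : involutive (hook_fun a b).
Proof.
by case=> c /=; case: ifP => ac /=; rewrite ?ac // tpermK eq_sym ac.
Qed.

Definition bd_hook r (a b : 'I_r) : bdiag r r :=
  mk_bdiag (@hook_neq r a b) (@hookK r a b).

(* The space spanned by the (k, l) diagrams; the parameter delta only matters
   for composition. *)
Definition brauer (K : fieldType) (delta : K) (k l : nat) :=
  {ffun bdiag k l -> K^o}.

Section BrauerSpaces.
Variables (K : fieldType) (delta : K).

Definition bvec k l (D : bdiag k l) : brauer delta k l :=
  [ffun D' => (D' == D)%:R].

Definition bcomp k l n (x : brauer delta l n) (y : brauer delta k l) :
    brauer delta k n :=
  \sum_(D1 : bdiag l n) \sum_(D2 : bdiag k l)
    (x D1 * y D2 * delta ^+ bd_loops D1 D2) *: bvec (bd_comp D1 D2).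

Definition btens k l k' l' (x : brauer delta k l) (y : brauer delta k' l') :
    brauer delta (k + k') (l + l') :=
  \sum_(D1 : bdiag k l) \sum_(D2 : bdiag k' l')
    (x D1 * y D2) *: bvec (bd_tens D1 D2).

(* Transport along equalities of the numbers of nodes, as [castmx]. *)
Definition bcast k l k' l' (eq_kl : (k = k') * (l = l'))
    (x : brauer delta k l) : brauer delta k' l' :=
  let: erefl in _ = l' := eq_kl.2 return brauer delta k' l' in
  let: erefl in _ = k' := eq_kl.1 return brauer delta k' l in x.

End BrauerSpaces.

Declare Scope brauer_scope.
Delimit Scope brauer_scope with B.
Notation "x \oB y" := (bcomp x y)
  (at level 40, left associativity) : brauer_scope.
Notation "x \otB y" := (btens x y)
  (at level 40, left associativity) : brauer_scope.
Local Open Scope brauer_scope.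

Section BrauerElements.
Variables (K : fieldType) (delta : K).

Definition bI q : brauer delta q q := bvec delta (bd_id q).
Definition bA q : brauer delta q.*2 0 := bvec delta (bd_cap q).
Definition bU q : brauer delta 0 q.*2 := bvec delta (bd_cup q).
Definition bX s t : brauer delta (s + t) (t + s) := bvec delta (bd_swap s t).

Definition Sigma_plus r : brauer delta r r :=
  \sum_(s : 'S_r) (-1) ^+ s *: bvec delta (bd_perm s).

(* A(k,l) in degree r; the node x : 'I_r is number x.+1 in its row. *)
Definition antisym r (k l : nat) : brauer delta r r :=
  if (k < l)%N then
    \sum_(s in Sym [set x : 'I_r | (k <= x.+1 <= l)%N])
      (-1) ^+ s *: bvec delta (bd_perm s)
  else bI r.

End BrauerElements.

Section MainElements.
Variables (K : fieldType) (m : nat).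

Local Notation delta := (m%:R : K).
Local Notation B := (brauer delta m.+1 m.+1).

Definition F_elt (p : nat) : B :=
  antisym delta m.+1 1 p \oB antisym delta m.+1 p.+1 m.+1.

(* e_{a,b}, with nodes a and b numbered from 1 *)
Definition e_ab (a b : nat) : B :=
  bvec delta (bd_hook (inord a.-1 : 'I_m.+1) (inord b.-1)).

Definition e_elt (i j : nat) : B :=
  \big[@bcomp K delta m.+1 m.+1 m.+1 / bI delta m.+1]_(0 <= t < j)
    e_ab (i - t) (i + 1 + t).

Lemma E_dim_mid (i : 'I_m.+2) (p := (m.+1 - i)%N) :
  (i + p.*2 + p = m.+1 + (p + p))%N.
Proof. by rewrite /p; have := ltn_ord i; lia. Qed.

Lemma E_dim_out (i : 'I_m.+2) (p := (m.+1 - i)%N) : (i + 0 + p = m.+1)%N.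
Proof. by rewrite /p; have := ltn_ord i; lia. Qed.

Definition E_elt (i : 'I_m.+2) : B :=
  let p := (m.+1 - i)%N in
  bcast (E_dim_mid i, E_dim_out i) (bI delta i \otB bA delta p \otB bI delta p)
  \oB (Sigma_plus delta m.+1 \otB bX delta p p)
  \oB bcast (E_dim_out i, E_dim_mid i)
        (bI delta i \otB bU delta p \otB bI delta p).

Definition Xi_elt (i j : nat) : B := F_elt i \oB e_elt i j \oB F_elt i.

Definition c_coef (i j : nat) : K :=
  (((i - j)`! * (m.+1 - i - j)`! * j`! ^ 2)%N%:R)^-1.

End MainElements.

(* Main.v *)
Require Import Defs.
From mathcomp Require Import all_boot all_order all_fingroup all_algebra.
From mathcomp Require Import zify.
Import GRing.Theory.
Local Open Scope ring_scope.

Set Implicit Arguments.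
Unset Strict Implicit.
Unset Printing Implicit Defensive.

Local Open Scope brauer_scope.

(** Cutting the row of [n = m + 1] nodes by a wall after node [i] turns both
    sides of the identity into signed sums over the symmetric group.

    Exchanging the lower and the upper node in every column to the right of the
    wall, a partial transposition, sends the diagram of a permutation [s] to
    some Brauer diagram [ptransp s].  Straightening the cups and caps in [E_i]
    shows that its term of index [s] is [ptransp (w * s * w)], [w] reversing
    the columns to the right of the wall; since conjugation by [w] preserves
    signs, [E_i] is the signed sum of all the [ptransp s] ([E_eltE]).

    On the other side, [F_i] is the signed sum over the Young subgroup [H] of
    the permutations that preserve the wall ([F_eltE]), and the nested arcs
    [e_i(j)] are [ptransp (nest j)] for a product [nest j] of [j] disjoint
    transpositions across the wall ([e_eltE]).  Composing [ptransp s] with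
    permutations from [H] multiplies [s] by elements of [H] on both sides: the
    left-hand columns act as they do on permutations, and the right-hand
    columns, being transposed, act from the opposite side and through inverses.
    Hence [F_i e_i(j) F_i] is the signed sum of the [ptransp (h * nest j * h')]
    for [h] and [h'] in [H], up to the sign [(-1)^j] of [nest j] ([F_pt_F]).
    No closed loop ever appears, so no power of the parameter does.

    It remains to see that the double cosets [H * nest j * H] partition the
    symmetric group and that [c_i(j)^-1] pairs [(h, h')] produce each of their
    elements.  A permutation [s] colours every point by the side of the wall on
    which it lies and by the side on which its image lies; factoring [s] as
    [h * t * h'] amounts to choosing [h] carrying the colouring of [s] to that
    of [t].  The sizes of the four colour classes are determined by the number
    of points that cross the wall from left to right, so such an [h] exists
    exactly when these numbers agree, and then there are as many of them as
    there are permutations preserving a colouring with classes of sizes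
    [i - j], [j], [j] and [n - i - j] ([card_factoring]).  In characteristic 0
    this number can be inverted, and it is the inverse of [c_i(j)]. *)

(** * Bilinearity of composition and juxtaposition *)

Section Bilinear.
Variables (K : fieldType) (delta : K).

Lemma bcomp_suml k l n (I : finType) (P : pred I) (a : I -> K)
    (x : I -> brauer delta l n) (y : brauer delta k l) :
  (\sum_(s | P s) a s *: x s) \oB y = \sum_(s | P s) a s *: (x s \oB y).
Proof.
rewrite /bcomp; under [RHS]eq_bigr => s _.
  rewrite scaler_sumr; under eq_bigr => D1 _ do rewrite scaler_sumr.
  over.
rewrite [RHS]exchange_big; apply: eq_bigr => D1 _.
rewrite [RHS]exchange_big; apply: eq_bigr => D2 _.
under [RHS]eq_bigr => s _ do rewrite scalerA.
rewrite -scaler_suml; congr (_ *: _).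
rewrite sum_ffunE !mulr_suml; apply: eq_bigr => s _.
by rewrite ffunE !mulrA.
Qed.

Lemma bcomp_sumr k l n (I : finType) (P : pred I) (a : I -> K)
    (x : brauer delta l n) (y : I -> brauer delta k l) :
  x \oB (\sum_(s | P s) a s *: y s) = \sum_(s | P s) a s *: (x \oB y s).
Proof.
rewrite /bcomp; under [RHS]eq_bigr => s _.
  rewrite scaler_sumr; under eq_bigr => D1 _ do rewrite scaler_sumr.
  over.
rewrite [RHS]exchange_big; apply: eq_bigr => D1 _.
rewrite [RHS]exchange_big; apply: eq_bigr => D2 _.
under [RHS]eq_bigr => s _ do rewrite scalerA.
rewrite -scaler_suml; congr (_ *: _).
rewrite sum_ffunE mulr_sumr mulr_suml; apply: eq_bigr => s _.
by rewrite ffunE !mulrA [_ * a s]mulrC.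
Qed.

Lemma btens_suml k l k' l' (I : finType) (P : pred I) (a : I -> K)
    (x : I -> brauer delta k l) (y : brauer delta k' l') :
  (\sum_(s | P s) a s *: x s) \otB y = \sum_(s | P s) a s *: (x s \otB y).
Proof.
rewrite /btens; under [RHS]eq_bigr => s _.
  rewrite scaler_sumr; under eq_bigr => D1 _ do rewrite scaler_sumr.
  over.
rewrite [RHS]exchange_big; apply: eq_bigr => D1 _.
rewrite [RHS]exchange_big; apply: eq_bigr => D2 _.
under [RHS]eq_bigr => s _ do rewrite scalerA.
rewrite -scaler_suml; congr (_ *: _).
rewrite sum_ffunE mulr_suml; apply: eq_bigr => s _.
by rewrite ffunE !mulrA.
Qed.

Lemma sum_bvec k l (V : lmodType K) (D : bdiag k l) (f : bdiag k l -> K)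
    (v : bdiag k l -> V) :
  \sum_D' (bvec delta D D' * f D') *: v D' = f D *: v D.
Proof.
rewrite (bigD1 D) //= big1 ?addr0 => [|D' neqD].
  by rewrite ffunE eqxx mul1r.
by rewrite ffunE (negPf neqD) mul0r scale0r.
Qed.

Lemma bcomp_bvec k l n (D1 : bdiag l n) (D2 : bdiag k l) :
  bvec delta D1 \oB bvec delta D2 =
  delta ^+ bd_loops D1 D2 *: bvec delta (bd_comp D1 D2).
Proof.
rewrite /bcomp.
under eq_bigr => E1 _ do under eq_bigr => E2 _ do rewrite -mulrA -scalerA.
under eq_bigr => E1 _ do rewrite -scaler_sumr.
under eq_bigr => E1 _ do rewrite -[bvec _ _ _]mulr1 sum_bvec.
by rewrite (sum_bvec D1 (fun=> 1)) scale1r.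
Qed.

Lemma btens_bvec k l k' l' (D : bdiag k l) (D' : bdiag k' l') :
  bvec delta D \otB bvec delta D' = bvec delta (bd_tens D D').
Proof.
rewrite /btens.
under eq_bigr => E1 _ do under eq_bigr => E2 _ do rewrite -scalerA.
under eq_bigr => E1 _ do rewrite -scaler_sumr.
rewrite -[RHS]scale1r.
rewrite -(sum_bvec D (fun=> 1) (fun E => bvec delta (bd_tens E D'))).
apply: eq_bigr => E1 _; rewrite mulr1; congr (_ *: _).
under eq_bigr => E2 _ do rewrite -[bvec _ _ _]mulr1.
by rewrite (sum_bvec D' (fun=> 1)) scale1r.
Qed.

End Bilinear.

(** * Tracing paths in a glued graph *)

Section Gluing.
Variables (k l n : nat) (D1 : bdiag l n) (D2 : bdiag k l).
Local Notation glue := (glue D1 D2).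

Lemma connect_dn x : connect glue (inl x) (inl (D2 x)).
Proof. by apply: connect1; rewrite /Defs.glue /= eqxx. Qed.

Lemma connect_up x : connect glue (of_up k x) (of_up k (D1 x)).
Proof.
by apply: connect1; rewrite /Defs.glue /= arc_up_of_up eqxx orbT.
Qed.

Lemma bd_compE x y :
  y != x -> connect glue (outer l x) (outer l y) -> bd_comp D1 D2 x = y.
Proof. by move=> yx xy; rewrite mk_bdiagE; apply/bd_comp_funP; rewrite yx. Qed.

Lemma bd_loops0 :
  (forall j, exists x, connect glue (inl (inr j)) (outer l x)) ->
  bd_loops D1 D2 = 0%N.
Proof.
move=> out; apply: eq_card0 => v; rewrite !inE.
apply/negP => /andP[_ /forallP noout].
have [x vx]: exists x, connect glue v (outer l x).
  case: v {noout} => [[d|j]|u]; last by exists (inr u).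
    by exists (inl d).
  exact: out.
by have := noout x; rewrite vx.
Qed.

Lemma bd_comp_eq (D : bdiag k n) :
  (forall x, connect glue (outer l x) (outer l (D x))) -> bd_comp D1 D2 = D.
Proof.
move=> conn; apply: val_inj; apply/ffunP => x.
exact: bd_compE (bd_neq D x) (conn x).
Qed.

(** The form in which compositions are computed below: it is enough to exhibit
    paths, because a component of the glued graph has at most two outer nodes,
    and a middle node that reaches an outer node lies on no closed loop. *)
Lemma bcomp_bvec_eq (K : fieldType) (delta : K) (D : bdiag k n) :
  (forall j, exists x, connect glue (inl (inr j)) (outer l x)) ->
  (forall x, connect glue (outer l x) (outer l (D x))) ->
  bcomp (bvec delta D1) (bvec delta D2) = bvec delta D.
Proof.
by move=> out conn; rewrite bcomp_bvec bd_loops0 // scale1r (bd_comp_eq conn).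
Qed.

End Gluing.

(** * Young subgroups and permutations preserving a colouring *)

Section YoungSubgroups.
Variable T : finType.
Implicit Types (A B S : {set T}) (s : {perm T}).

Lemma Sym_TI A B : [disjoint A & B] -> (Sym A :&: Sym B)%g = 1%g.
Proof.
move=> dAB; apply/trivgP/subsetP => s; rewrite !inE => /andP[onA onB].
apply/eqP/permP => x; rewrite perm1; apply/eqP; apply: contraTT dAB => sx.
by apply/pred0Pn; exists x; rewrite /= (subsetP onA) ?(subsetP onB).
Qed.

(** The first factor is the restriction of [s] to [A]. *)
Lemma Sym_split A S s :
    s \in Sym S -> A \subset S -> {in A, forall x, s x \in A} ->
  exists2 a, a \in Sym A & exists2 b, b \in Sym (S :\: A) & s = (a * b)%g.
Proof.
move=> onS sAS sA; have Ns : s \in 'N(A | 'P)%g.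
  by rewrite !inE; apply/subsetP => x Ax; rewrite inE; apply: sA.
exists (restr_perm A s); first by rewrite inE restr_perm_on.
exists ((restr_perm A s)^-1 * s)%g; last by rewrite mulKVg.
rewrite !inE in onS *; apply/subsetP => x; rewrite !inE => sx.
have [Ax|nAx] /= := boolP (x \in A).
  have Ay : (restr_perm A s)^-1%g x \in A.
    by rewrite (perm_closed _ (perm_onV (restr_perm_on A s))).
  by move: sx; rewrite permM -(restr_permE Ns Ay) permKV eqxx.
apply: (subsetP onS); rewrite inE.
by move: sx; rewrite permM (out_perm (perm_onV (restr_perm_on A s)) nAx).
Qed.

Definition set_stab A : {set {perm T}} :=
  [set s : {perm T} | [forall x in A, s x \in A]].

Lemma set_stabP A s :
  reflect (forall x, (s x \in A) = (x \in A)) (s \in set_stab A).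
Proof.
rewrite inE; apply: (iffP forall_inP) => [sA x|sA x Ax]; last by rewrite sA.
have sAE : s @: A = A.
  apply/eqP; rewrite eqEcard card_imset ?leqnn ?andbT; last exact: perm_inj.
  by apply/subsetP => _ /imsetP[y Ay ->]; apply: sA.
by rewrite -{1}sAE mem_imset //; apply: perm_inj.
Qed.

Lemma Sym_stab A s : s \in Sym A -> s \in set_stab A.
Proof.
by rewrite inE => onA; apply/set_stabP => x; rewrite (perm_closed _ onA).
Qed.

Lemma Sym_stabC A s : s \in Sym (~: A) -> s \in set_stab A.
Proof.
by rewrite inE => onA; apply/set_stabP => x; apply: negb_inj;
   rewrite -!in_setC (perm_closed _ onA).
Qed.

Lemma set_stabM A s t :
  s \in set_stab A -> t \in set_stab A -> (s * t)%g \in set_stab A.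
Proof.
by move=> /set_stabP sA /set_stabP tA; apply/set_stabP => x; rewrite permM tA sA.
Qed.

Lemma set_stabE A : set_stab A = (Sym A * Sym (~: A))%g.
Proof.
apply/setP => s; apply/idP/mulsgP => [sA|[a b aA bA ->]].
  have sT : s \in Sym [set: T] by rewrite inE; apply/subsetP => x; rewrite inE.
  have [|x Ax|a aA [b bA ->]] := @Sym_split A [set: T] s sT.
  - exact: subsetT.
  - by rewrite (set_stabP _ _ sA).
  - by exists a b; rewrite // -setTD.
by rewrite set_stabM ?(Sym_stab aA) ?(Sym_stabC bA).
Qed.

Lemma big_set_stab (V : nmodType) A (f : {perm T} -> V) :
  \sum_(h in set_stab A) f h =
  \sum_(a in Sym A) \sum_(b in Sym (~: A)) f (a * b)%g.
Proof.
have inj :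
    {in setX (Sym A) (Sym (~: A)) &, injective (fun p => p.1 * p.2)%g}.
  case=> a b [a' b']; rewrite !in_setX => /andP[aA bA] /andP[aA' bA'] /= eq_ab.
  have : (a'^-1 * a)%g \in (Sym A :&: Sym (~: A))%g.
    rewrite inE groupM ?groupV //=.
    by rewrite -[a](mulgK b) eq_ab mulgA mulKg groupM ?groupV.
  rewrite Sym_TI -?setI_eq0 ?setICr // => /set1P aa'.
  have aa : a = a' by rewrite -[a](mulKVg a') aa' mulg1.
  by move: eq_ab; rewrite aa => /mulgI ->.
rewrite pair_big_dep /= set_stabE.
have -> : (Sym A * Sym (~: A))%g =
          [set p.1 * p.2 | p in setX (Sym A) (Sym (~: A))]%g.
  apply/setP => s; apply/mulsgP/imsetP => [[a b aA bA ->]|[[a b]]].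
    by exists (a, b); rewrite // in_setX aA.
  by rewrite in_setX => /andP[aA bA] ->; exists a b.
by rewrite big_imset //=; apply: eq_bigl => -[a b]; rewrite in_setX.
Qed.

Section Colourings.
Variables (C : finType) (c : T -> C).

Definition colour_perms S : {set {perm T}} :=
  [set s in Sym S | [forall x, c (s x) == c x]].

Lemma colour_permsP S s :
  reflect (s \in Sym S /\ forall x, c (s x) = c x) (s \in colour_perms S).
Proof.
apply: (iffP setIdP) => -[sS sc]; split=> //.
  by move=> x; apply/eqP; move: x; apply/forallP.
by apply/forallP => x; rewrite sc.
Qed.

Lemma colour_perms_group S : group_set (colour_perms S).
Proof.
apply/group_setP; split=> [|s t /colour_permsP[sS sc] /colour_permsP[tS tc]].
  by apply/colour_permsP; split=> [|x]; rewrite ?group1 ?perm1.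
by apply/colour_permsP; split=> [|x]; rewrite ?groupM ?permM ?tc ?sc.
Qed.
Canonical colour_perms_groupType S := Group (colour_perms_group S).

(** A colour-preserving permutation restricts to each class.  The induction adds the
    classes one at a time, splitting off the symmetric group of the new one. *)
Lemma card_colour_perms :
  #|[set s : {perm T} | [forall x, c (s x) == c x]]| =
  (\prod_(k : C) #|[set x | c x == k]|`!)%N.
Proof.
pose block k := [set x | c x == k]; pose U (ks : seq C) := [set x | c x \in ks].
have cardU ks : uniq ks ->
    #|colour_perms (U ks)| = (\prod_(k <- ks) #|block k|`!)%N.
  elim: ks => [_|k ks IHks /= /andP[nks uks]].
    rewrite big_nil (_ : colour_perms _ = 1%g) ?cards1 //.
    apply/trivgP/subsetP => s /colour_permsP[]; rewrite inE => onU _.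
    apply/set1P/permP => x; rewrite perm1 (out_perm onU) //.
    by rewrite inE in_nil.
  have dsj : [disjoint block k & U ks].
    rewrite -setI_eq0; apply/eqP/setP => x; rewrite !inE.
    by apply/andP => -[/eqP->]; rewrite (negPf nks).
  rewrite big_cons -IHks // -card_Sym -TI_cardMg; last first.
    apply/trivgP; rewrite -(Sym_TI dsj) setIS //.
    by apply/subsetP => s /colour_permsP[].
  have subU B : B \subset U (k :: ks) -> {subset Sym B <= Sym (U (k :: ks))}.
    by move=> sB s; rewrite !inE => /subset_trans; apply.
  have cSym a : a \in Sym (block k) -> forall x, c (a x) = c x.
    rewrite inE => onk x; have [kx|nkx] := boolP (x \in block k).
      have akx : a x \in block k by rewrite (perm_closed _ onk).
      by move: kx akx; rewrite !inE => /eqP-> /eqP.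
    by rewrite (out_perm onk).
  apply: eq_card => s; apply/colour_permsP/mulsgP.
  - case=> sU sc; have [| |a ak [b bk sE]] := @Sym_split (block k) _ s sU.
    + by apply/subsetP => x; rewrite !inE => /eqP->; rewrite eqxx.
    + by move=> x; rewrite !inE sc.
    exists a b => //; apply/colour_permsP; split=> [|x].
      rewrite (_ : U ks = U (k :: ks) :\: block k) //.
      apply/setP => x; rewrite !inE.
      by case: eqP => [->|] //=; rewrite (negPf nks).
    have -> : b x = s (a^-1%g x) by rewrite sE permM permKV.
    by rewrite sc -(cSym a ak (a^-1%g x)) permKV.
  - case=> a b ak /colour_permsP[bU bc] ->; split=> [|x].
      rewrite groupM //.
        apply: subU ak; apply/subsetP => x; rewrite !inE => /eqP->.
        by rewrite eqxx.
      by apply: subU bU; apply/subsetP => x; rewrite !inE => ->; rewrite orbT.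
    by rewrite permM bc cSym.
rewrite [RHS](_ : _ = \prod_(k <- index_enum C) #|block k|`!)%N //.
rewrite -cardU ?index_enum_uniq //; apply: eq_card => s.
apply/idP/colour_permsP => [|[_ sc]]; last first.
  by rewrite inE; apply/forallP => x; rewrite sc.
rewrite inE => /forallP sc.
split=> [|x]; last by apply/eqP.
by rewrite inE; apply/subsetP => x _; rewrite inE mem_index_enum.
Qed.

End Colourings.

End YoungSubgroups.

(** * Double cosets of a Young subgroup *)

Lemma ex_recolouring n (C : eqType) (c c' : 'I_n -> C) :
  (forall k, #|[set x | c x == k]| = #|[set x | c' x == k]|) ->
  exists h : 'S_n, forall x, c' (h x) = c x.
Proof.
move=> eq_cc'.
have cnt (d : 'I_n -> C) k :
    count_mem k [tuple d x | x < n] = #|[set x | d x == k]|.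
  rewrite -[tval _]/(map d (val (ord_tuple n))) val_ord_tuple count_map.
  rewrite cardE [in RHS]/enum_mem -enumT size_filter.
  by apply: eq_count => x; rewrite /= inE.
have /tuple_permP[h hP] : perm_eq [tuple c x | x < n] [tuple c' x | x < n].
  by apply/allP => k _; rewrite /= !cnt eq_cc'.
exists h => x; have := congr1 (fun u : seq C => nth (c x) u x) hP.
by rewrite !nth_mktuple tnth_mktuple.
Qed.

Section DoubleCosets.
Variables (n : nat) (L : {set 'I_n}).
Implicit Types s t h : 'S_n.
Local Notation H := (set_stab L).

Definition crossings s : nat := #|[set x in L | s x \notin L]|.

Definition sides s (x : 'I_n) : bool * bool := (x \in L, s x \in L).

Definition side_count s (k : bool * bool) : nat :=
  #|[set x | sides s x == k]|.

(** As many points cross from left to right as from right to left, because [L]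
    and its preimage have the same size. *)
Lemma crossingsE s :
  [/\ side_count s (true, false) = crossings s,
      side_count s (false, true) = crossings s,
      (side_count s (true, true) + crossings s = #|L|)%N &
      (side_count s (false, false) + crossings s = #|~: L|)%N].
Proof.
have TF : side_count s (true, false) = crossings s.
  by apply: eq_card => x; rewrite !inE xpair_eqE; do 2 case: (_ \in L).
have TT : (side_count s (true, true) + crossings s = #|L|)%N.
  rewrite -TF -(cardsID [set x | s x \in L] L).
  by congr (_ + _)%N; apply: eq_card => x; rewrite !inE xpair_eqE;
     do 2 case: (_ \in L).
have TV : (side_count s (true, true) + side_count s (false, true) = #|L|)%N.
  rewrite -(card_imset _ (@perm_inj _ s^-1)) (_ : _ @: _ = [set x | s x \in L]).
    rewrite -(cardsID L); congr (_ + _)%N; apply: eq_card => x;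
    by rewrite !inE xpair_eqE; do 2 case: (_ \in L).
  apply/setP => x; rewrite inE; apply/imsetP/idP => [[y Ly ->]|Lx].
    by rewrite permKV.
  by exists (s x); rewrite ?permK.
have FF :
    (side_count s (false, true) + side_count s (false, false) = #|~: L|)%N.
  rewrite -(cardsID [set x | s x \in L] (~: L)).
  by congr (_ + _)%N; apply: eq_card => x; rewrite !inE xpair_eqE;
     do 2 case: (_ \in L).
by split=> //; lia.
Qed.

Lemma crossings_le s : (crossings s <= minn #|L| #|~: L|)%N.
Proof. by have [_ _ <- <-] := crossingsE s; rewrite leq_min !leq_addl. Qed.

Lemma eq_side_count s t k :
  crossings s = crossings t -> side_count s k = side_count t k.
Proof.
have [s1 s2 s3 s4] := crossingsE s; have [t1 t2 t3 t4] := crossingsE t.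
by case: k => [[] []]; lia.
Qed.

(** The left factors [h] of the factorizations [s = h * t * h'] with [h] and
    [h'] in [H]; the right factor is determined by [h]. *)
Definition factoring t s : {set 'S_n} :=
  [set h in H | ((h * t)^-1 * s)%g \in H].

Lemma factoringP t s h :
  reflect (forall x, sides t (h x) = sides s x) (h \in factoring t s).
Proof.
apply: (iffP setIdP) => [[/set_stabP hH /set_stabP sH] x|sides_h].
  congr (_, _); first exact: hH.
  by have := sH ((h * t)%g x); rewrite -permM mulKVg permM => ->.
split; apply/set_stabP => x; first by have [] := sides_h x.
have [_] := sides_h ((h * t)^-1%g x).
by rewrite -[t _]permM permKV => ->; rewrite permM.
Qed.

Lemma card_factoring t s :
  #|factoring t s| =
    if crossings s == crossings t then
      ((#|L| - crossings t)`! * (#|~: L| - crossings t)`!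
       * (crossings t)`! ^ 2)%N
    else 0%N.
Proof.
case: eqP => [eq_st|neq_st]; last first.
  apply: eq_card0 => h; apply/negP => /factoringP sides_h; apply: neq_st.
  have [<- _ _ _] := crossingsE s; have [<- _ _ _] := crossingsE t.
  rewrite /side_count -[RHS](card_imset _ (@perm_inj _ h^-1)).
  apply: eq_card => x; rewrite inE -sides_h.
  apply/idP/imsetP => [hx|[y + ->]]; last by rewrite permKV inE.
  by exists (h x); rewrite ?permK ?inE.
have [h0 h0P] : exists h, forall x, sides t (h x) = sides s x.
  by apply: ex_recolouring => k; apply: eq_side_count.
(* all the factorizations differ from a given one by a symmetry of [sides t] *)
have -> : factoring t s =
    (h0 *: [set g : 'S_n | [forall x, sides t (g x) == sides t x]])%g.
  apply/setP => h; rewrite mem_lcoset [in RHS]inE.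
  apply/factoringP/forallP => hP x.
    by rewrite permM hP -h0P permKV.
  by have /eqP := hP (h0 x); rewrite permM permK h0P.
rewrite card_lcoset card_colour_perms.
rewrite -(pair_bigA _ (fun a b => #|[set x | sides t x == (a, b)]|`!)%N) /=.
rewrite !big_bool /=.
have [tf ft tt ff] := crossingsE t; rewrite /side_count in tf ft tt ff.
rewrite tf ft -tt -ff !addnK.
by rewrite -mulnn [X in (_ * X)%N = _]mulnC mulnACA.
Qed.

Lemma sum_double_coset (V : nmodType) t (f : 'S_n -> V) :
  \sum_(h in H) \sum_(h' in H) f (h * t * h')%g =
  \sum_s f s *+ #|factoring t s|.
Proof.
under eq_bigr => h _.
  rewrite (reindex_inj (mulgI (h * t)^-1)%g) /=.
  under eq_bigr => s _ do rewrite mulKVg.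
  over.
rewrite (exchange_big_dep predT) //=; apply: eq_bigr => s _.
by rewrite sumr_const; congr (_ *+ _); apply: eq_card => h; rewrite inE.
Qed.

End DoubleCosets.

(** * Partial transposes of permutation diagrams *)

Section PartialTranspose.
Variables (n : nat) (L : {set 'I_n}).
Implicit Types s h : 'S_n.

Definition flip (x : 'I_n + 'I_n) : 'I_n + 'I_n :=
  match x with
  | inl c => if c \in L then inl c else inr c
  | inr c => if c \in L then inr c else inl c
  end.

Lemma flipK : involutive flip.
Proof. by case=> c /=; case: ifP => cL /=; rewrite cL. Qed.

Lemma bd_perm_inl s c : bd_perm s (inl c) = inr (s c).
Proof. by rewrite mk_bdiagE. Qed.

Lemma bd_perm_inr s c : bd_perm s (inr (s c)) = inl c.
Proof. by rewrite mk_bdiagE /= permK. Qed.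

Definition transpose_fun s x := flip (bd_perm s (flip x)).

Lemma transpose_neq s x : transpose_fun s x != x.
Proof.
by rewrite -(inj_eq (can_inj flipK)) /transpose_fun flipK bd_neq.
Qed.

Lemma transposeK s : involutive (transpose_fun s).
Proof. by move=> x; rewrite /transpose_fun flipK bdK flipK. Qed.

Definition ptransp s : bdiag n n := mk_bdiag (@transpose_neq s) (@transposeK s).

Lemma pt_inl s c : ptransp s (flip (inl c)) = flip (inr (s c)).
Proof. by rewrite mk_bdiagE /transpose_fun flipK bd_perm_inl. Qed.

Lemma pt_inr s c : ptransp s (flip (inr (s c))) = flip (inl c).
Proof. by rewrite mk_bdiagE /transpose_fun flipK bd_perm_inr. Qed.

(** Every arc of a partial transpose has one end in the image of the lower row
    under [flip], so tracing these ends only is enough. *)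
Lemma bcomp_pt_eq (K : fieldType) (delta : K) l
    (D1 : bdiag l n) (D2 : bdiag n l) s :
  (forall j, exists x, connect (glue D1 D2) (inl (inr j)) (outer l x)) ->
  (forall c, connect (glue D1 D2) (outer l (flip (inl c)))
                                  (outer l (flip (inr (s c))))) ->
  bvec delta D1 \oB bvec delta D2 = bvec delta (ptransp s).
Proof.
move=> out conn; apply: bcomp_bvec_eq => // x.
rewrite -[x]flipK; case: (flip x) => c; first by rewrite pt_inl.
by rewrite -(permKV s c) pt_inr glue_connect_sym.
Qed.

Section PermutationFactor.
Variables (K : fieldType) (delta : K) (a b : 'S_n).
Hypotheses (aL : a \in Sym L) (bL : b \in Sym (~: L)).

Let ona : perm_on L a. Proof. by have := aL; rewrite inE. Qed.
Let onb : perm_on (~: L) b. Proof. by have := bL; rewrite inE. Qed.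

Lemma young_in c : c \in L -> ((a * b)%g c = a c) /\ b c = c.
Proof.
move=> cL; split; last by rewrite (out_perm onb) ?inE ?cL.
by rewrite permM (out_perm onb) // inE (perm_closed _ ona) cL.
Qed.

Lemma young_notin c : c \notin L -> ((a * b)%g c = b c) /\ a c = c.
Proof.
by move=> cL; rewrite permM (out_perm ona).
Qed.

(** The permutation placed on top relabels the upper row.  After transposition
    the upper nodes outside [L] are the inputs of [s], so [b] enters there, and
    through its inverse. *)
Lemma bcomp_perm_pt s :
  bvec delta (bd_perm (a * b)) \oB bvec delta (ptransp s) =
  bvec delta (ptransp (b^-1 * s * a)).
Proof.
pose up (x : 'I_n + 'I_n) : 'I_n + 'I_n :=
  if x is inr j then inr ((a * b)%g j) else x.
have conn x :
    connect (glue (bd_perm (a * b)) (ptransp s)) (inl x) (outer n (up x)).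
  case: x => [d|j] //; have := connect_up (bd_perm (a * b)) (ptransp s) (inl j).
  by rewrite bd_perm_inl.
have upL c : up (flip (inl c)) = flip (inl (b c)).
  rewrite /=; case: ifP => cL; first by rewrite (young_in cL).2 cL.
  have bcL : b c \notin L.
    by rewrite -in_setC (perm_closed _ onb) inE cL.
  by rewrite /up (young_notin (negbT cL)).1 (negPf bcL).
have upR c : up (flip (inr c)) = flip (inr (a c)).
  rewrite /=; case: ifP => cL /=.
    by rewrite (young_in cL).1 (perm_closed _ ona) cL.
  by rewrite (young_notin (negbT cL)).2 cL.
apply: bcomp_pt_eq => [j|c]; first by exists (up (inr j)); apply: conn.
rewrite -(permKV b c) -upL !permM permK -upR -pt_inl.
apply: connect_trans (conn _); rewrite glue_connect_sym.
by apply: connect_trans (conn _); rewrite glue_connect_sym; apply: connect_dn.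
Qed.

Lemma bcomp_pt_perm s :
  bvec delta (ptransp s) \oB bvec delta (bd_perm (a * b)) =
  bvec delta (ptransp (a * s * b^-1)).
Proof.
pose dn (x : 'I_n + 'I_n) : 'I_n + 'I_n :=
  if x is inl j then inl ((a * b)^-1%g j) else x.
have conn x :
    connect (glue (ptransp s) (bd_perm (a * b))) (of_up n x) (outer n (dn x)).
  case: x => [j|u] //; have := connect_dn (ptransp s) (bd_perm (a * b)) (inr j).
  by rewrite mk_bdiagE.
have dnL c : dn (flip (inl (a c))) = flip (inl c).
  rewrite /=; case: ifP => acL.
    move: acL; rewrite (perm_closed _ ona) => cL.
    by rewrite /dn -(young_in cL).1 permK cL.
  move: acL; rewrite (perm_closed _ ona) => cL.
  by rewrite (young_notin (negbT cL)).2 cL.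
have dnR c : dn (flip (inr (b c))) = flip (inr c).
  have bcL : (b c \in L) = (c \in L).
    by apply: negb_inj; rewrite -!in_setC (perm_closed _ onb).
  rewrite /= bcL; case: ifP => cL; first by rewrite (young_in cL).2.
  by rewrite /dn -(young_notin (negbT cL)).1 permK.
apply: bcomp_pt_eq => [j|c].
  by exists (dn (inl j)); apply: (conn (inl j)).
rewrite -dnL -dnR !permM permKV -pt_inl.
apply: connect_trans (conn _); rewrite glue_connect_sym.
by apply: connect_trans (conn _); rewrite glue_connect_sym; apply: connect_up.
Qed.

End PermutationFactor.

(** Stacking a hook on a diagram that is vertical in columns [a] and [b]
    replaces these two verticals by arcs; in the transposed picture this
    composes [s] with the transposition of [a] and [b]. *)
Lemma bcomp_hook_pt (K : fieldType) (delta : K) (a b : 'I_n) s :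
    a \in L -> b \notin L -> s a = a -> s b = b ->
  bvec delta (bd_hook a b) \oB bvec delta (ptransp s) =
  bvec delta (ptransp (tperm a b * s)).
Proof.
move=> aL bL sa sb; set G := glue (bd_hook a b) (ptransp s).
have ab : a != b by apply: contraNneq bL => <-.
have hookl c : bd_hook a b (inl c) =
    if tperm a b c == c then inr c else inl (tperm a b c).
  by rewrite mk_bdiagE.
have hookr c : bd_hook a b (inr c) =
    if tperm a b c == c then inl c else inr (tperm a b c).
  by rewrite mk_bdiagE.
have conn x : x != inr a -> x != inr b -> connect G (inl x) (outer n x).
  case: x => [d|j] // ja jb.
  have := connect_up (bd_hook a b) (ptransp s) (inl j).
  by rewrite hookl tpermD ?eqxx //; [move: ja|move: jb]; rewrite eq_sym.
have pta : ptransp s (inr a) = inl a.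
  by have := pt_inr s a; rewrite sa /= aL.
have ptb : ptransp s (inr b) = inl b.
  by have := pt_inl s b; rewrite sb /= (negPf bL).
have mida : connect G (inl (inr a)) (inl (inl a)).
  by rewrite -pta; apply: connect_dn.
have midb : connect G (inl (inr b)) (inl (inl b)).
  by rewrite -ptb; apply: connect_dn.
apply: bcomp_pt_eq => [j|c].
  have [->|ja] := eqVneq j a; first by exists (inl a).
  have [->|jb] := eqVneq j b; first by exists (inl b).
  by exists (inr j); apply: conn.
rewrite permM; have [->|ca] := eqVneq c a.
  rewrite tpermL sb /= aL (negPf bL) /=.
  apply: connect_trans midb; rewrite glue_connect_sym.
  apply: connect_trans mida; rewrite glue_connect_sym.
  have := connect_up (bd_hook a b) (ptransp s) (inl a).
  by rewrite hookl tpermL eq_sym (negPf ab).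
have [->|cb] := eqVneq c b.
  rewrite tpermR sa /= aL (negPf bL) /=.
  have := connect_up (bd_hook a b) (ptransp s) (inr b).
  by rewrite hookr tpermR (negPf ab).
rewrite tpermD 1?eq_sym //.
have sca : s c != a by rewrite -sa (inj_eq perm_inj).
have scb : s c != b by rewrite -sb (inj_eq perm_inj).
have conn_flip x : x != inl a -> x != inl b -> x != inr a -> x != inr b ->
    connect G (inl (flip x)) (outer n (flip x)).
  by case: x => x xa xb ya yb; apply: conn => /=; case: ifP.
rewrite -pt_inl.
apply: (@connect_trans _ _ (inl (ptransp s (flip (inl c))))); last first.
  by rewrite pt_inl; apply: conn_flip.
apply: (@connect_trans _ _ (inl (flip (inl c)))); last exact: connect_dn.
by rewrite glue_connect_sym; apply: conn_flip.
Qed.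

End PartialTranspose.

Lemma bd_perm_pt n (s : 'S_n) : bd_perm s = ptransp setT s.
Proof.
suff E x : bd_perm s x = ptransp setT s x.
  by apply: val_inj; apply/ffunP => x; apply: E.
have flipT y : flip setT y = y by case: y => c; rewrite /= in_setT.
by rewrite [RHS]mk_bdiagE /transpose_fun !flipT.
Qed.

Lemma bcomp_perm (K : fieldType) (delta : K) n (s t : 'S_n) :
  bvec delta (bd_perm s) \oB bvec delta (bd_perm t) =
  bvec delta (bd_perm (t * s)).
Proof.
rewrite [bd_perm t]bd_perm_pt [bd_perm (t * s)]bd_perm_pt.
rewrite -{1}[s]mulg1 bcomp_perm_pt ?group1 ?invg1 ?mul1g //.
by rewrite inE; apply/subsetP => x; rewrite inE.
Qed.

(** * The right-hand side: antisymmetrizers and nested arcs *)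

Lemma card_ord_interval n a b :
  (b <= n)%N -> #|[set x : 'I_n | (a <= x < b)%N]| = (b - a)%N.
Proof.
move=> le_bn; rewrite -[RHS]muln1 -sum_nat_const_nat.
rewrite (big_nat_widenl _ 0) // (big_nat_widen _ _ n) // big_mkord -sum1_card.
by apply: eq_bigl => x; rewrite inE.
Qed.

Section Antisymmetrizers.
Variables (K : fieldType) (delta : K) (n : nat).

Lemma bd_perm1 : bd_perm (1 : 'S_n) = bd_id n.
Proof.
by apply: val_inj; apply/ffunP => -[] x; rewrite !ffunE /= ?invg1 perm1.
Qed.

Lemma antisymE k l :
  antisym delta n k l =
  \sum_(s in Sym [set x : 'I_n | (k <= x.+1 <= l)%N])
    (-1) ^+ s *: bvec delta (bd_perm s).
Proof.
rewrite /antisym; case: ltnP => // le_lk.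
rewrite (big_pred1 1%g) => [|s]; first by rewrite odd_perm1 scale1r bd_perm1.
apply/idP/eqP => [|->]; last exact: group1.
rewrite inE => /perm_on_id; apply.
rewrite (@leq_trans #|[set x : 'I_n | (l.-1 <= x < minn l n)%N]|) //.
  apply: subset_leq_card; apply/subsetP => x; rewrite !inE.
  by have := ltn_ord x; lia.
by rewrite card_ord_interval; lia.
Qed.

Lemma antisym_mulC (A B : {set 'I_n}) : [disjoint A & B] ->
  @bcomp K delta n n n
    (\sum_(a in Sym A) (-1) ^+ a *: bvec delta (bd_perm a))
    (\sum_(b in Sym B) (-1) ^+ b *: bvec delta (bd_perm b)) =
  \sum_(a in Sym A) \sum_(b in Sym B)
    (-1) ^+ (a * b)%g *: bvec delta (bd_perm (a * b)).
Proof.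
move=> dAB; rewrite bcomp_suml; apply: eq_bigr => a aA.
rewrite bcomp_sumr scaler_sumr; apply: eq_bigr => b bB.
rewrite scalerA -signr_addb -odd_permM bcomp_perm.
congr (_ *: bvec _ (bd_perm _)).
by rewrite !inE in aA bB; rewrite (perm_onC aA bB).
Qed.

End Antisymmetrizers.

Section NestedArcs.
Variables (K : fieldType) (m i : nat).
Local Notation n := m.+1.
Local Notation delta := (m%:R : K).

Definition wall : {set 'I_n} := [set x : 'I_n | (x < i)%N].

Lemma F_eltE : F_elt K m i =
  \sum_(h in set_stab wall) (-1) ^+ h *: bvec delta (bd_perm h).
Proof.
rewrite big_set_stab /F_elt !antisymE -antisym_mulC; last first.
  by rewrite -setI_eq0 setICr.
by congr (_ \oB _); apply: eq_bigl => s; congr (s \in Sym _); apply/setP => x;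
  rewrite !inE; have := ltn_ord x; lia.
Qed.

(** Nodes are numbered from 0 here: in the picture, [nest 0 j] exchanges the [j]
    columns to the left of the wall with the [j] columns to its right by
    reflection, and [nest s j] does so except in the [s] columns nearest to the
    wall on either side. *)
Definition nest s j : 'S_n :=
  (\prod_(s <= t < j) tperm (inord (i - t).-1) (inord (i + 1 + t).-1))%g.

Lemma nestE s j (c : 'I_n) :
    (s <= j)%N -> (j <= i)%N -> (i + j <= n)%N ->
  nest s j c =
    (if (i - j <= c < i - s) || (i + s <= c < i + j) then i.*2.-1 - c else c)%N
    :> nat.
Proof.
move=> le_sj le_ji le_n; rewrite -(subKn le_sj).
have : (j - s <= j)%N by lia.
elim: (j - s)%N c => [|d IHd] c le_dj.
  by rewrite /nest big_geq ?perm1; [case: ifP; lia | lia].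
rewrite /nest big_ltn; last lia.
rewrite permM (_ : (j - d.+1).+1 = (j - d)%N); last lia.
rewrite -/(nest _ _) IHd; last lia.
have va : (inord (i - (j - d.+1)).-1 : 'I_n) = (i - (j - d.+1)).-1 :> nat.
  by rewrite inordK; lia.
have vb : (inord (i + 1 + (j - d.+1)).-1 : 'I_n) = (i + 1 + (j - d.+1)).-1 :> nat.
  by rewrite inordK; lia.
case: tpermP => [->|->|/eqP ca /eqP cb]; rewrite ?va ?vb.
- by do 2 case: ifP; lia.
- by do 2 case: ifP; lia.
by move: ca cb; rewrite -!val_eqE /= va vb; do 2 case: ifP; lia.
Qed.

Lemma pt1 (L : {set 'I_n}) : ptransp L 1 = bd_id n.
Proof.
apply: val_inj; apply/ffunP => x; rewrite !ffunE /transpose_fun bd_perm1.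
by case: x => c /=; case: ifP => cL /=; rewrite mk_bdiagE /= cL.
Qed.

Lemma odd_nest j : (j <= i)%N -> (i + j <= n)%N -> nest 0 j = odd j :> bool.
Proof.
elim: j => [|j IHj] le_ji le_n; first by rewrite /nest big_geq ?odd_perm1.
rewrite /nest big_nat_recr //= odd_permM -/(nest 0 j) IHj; [|lia|lia].
rewrite odd_tperm; case: eqP => [/(congr1 val)|_]; last by case: odd.
by rewrite /= !inordK; lia.
Qed.

Lemma crossings_nest j :
  (j <= i)%N -> (i + j <= n)%N -> crossings wall (nest 0 j) = j.
Proof.
move=> le_ji le_n; rewrite /crossings.
rewrite (_ : [set x in _ | _] = [set x : 'I_n | (i - j <= x < i)%N]).
  by rewrite card_ord_interval; lia.
apply/setP => x; rewrite !inE nestE //.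
by case: ifP; lia.
Qed.

Lemma e_eltE j :
  (j <= i)%N -> (i + j <= n)%N ->
  e_elt K m i j = bvec delta (ptransp wall (nest 0 j)).
Proof.
move=> le_ji le_n; rewrite /e_elt.
suff gen d : (d <= j)%N ->
    \big[@bcomp K delta n n n / bI delta n]_(j - d <= t < j)
      e_ab K m (i - t) (i + 1 + t) = bvec delta (ptransp wall (nest (j - d) j)).
  by have := gen j (leqnn j); rewrite subnn.
elim: d => [|d IHd] le_dj.
  by rewrite /nest !big_geq ?pt1 //; lia.
rewrite big_ltn; last lia.
rewrite (_ : (j - d.+1).+1 = (j - d)%N); last lia.
rewrite IHd; last lia.
rewrite /e_ab bcomp_hook_pt.
- rewrite /nest [in RHS]big_ltn; last lia.
  by rewrite (_ : (j - d.+1).+1 = (j - d)%N); last lia.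
- by rewrite inE inordK; lia.
- by rewrite inE inordK; lia.
- apply: val_inj; rewrite /= nestE; [|lia..].
  by rewrite inordK; [case: ifP; lia | lia].
- apply: val_inj; rewrite /= nestE; [|lia..].
  by rewrite inordK; [case: ifP; lia | lia].
Qed.

(** Of the four factors in the two copies of [F], the left-hand part of the
    upper one meets the right-hand part of the lower one on the right of [s],
    and the other two meet on its left; summing over inverses removes the inverses
    coming from the transposed columns. *)
Lemma F_pt_F s :
  F_elt K m i \oB bvec delta (ptransp wall s) \oB F_elt K m i =
  \sum_(h in set_stab wall) \sum_(h' in set_stab wall)
    (-1) ^+ h *: ((-1) ^+ h' *: bvec delta (ptransp wall (h * s * h'))).
Proof.
rewrite F_eltE !bcomp_suml big_set_stab.
transitivity (\sum_(a in Sym wall) \sum_(b in Sym (~: wall))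
  \sum_(a' in Sym wall) \sum_(b' in Sym (~: wall))
  (-1) ^+ (a * b)%g *: ((-1) ^+ (a' * b')%g *:
    bvec delta (ptransp wall (a' * (b * s * a) * b')))).
  apply: eq_bigr => a aL; rewrite [RHS](reindex_inj invg_inj).
  rewrite [RHS](eq_bigl (fun b => b \in Sym (~: wall))); last first.
    by move=> b; rewrite groupV.
  apply: eq_bigr => b bL; rewrite bcomp_perm_pt // bcomp_sumr scaler_sumr.
  rewrite big_set_stab; apply: eq_bigr => a' aL'.
  rewrite [RHS](reindex_inj invg_inj).
  rewrite [RHS](eq_bigl (fun b => b \in Sym (~: wall))); last first.
    by move=> b'; rewrite groupV.
  by apply: eq_bigr => b' bL'; rewrite bcomp_pt_perm // !odd_permM !odd_permV.
rewrite big_set_stab exchange_big /=.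
under eq_bigr => b _ do rewrite exchange_big /=.
rewrite exchange_big /=; apply: eq_bigr => a' _; apply: eq_bigr => b _.
rewrite big_set_stab; apply: eq_bigr => a _; apply: eq_bigr => b' _.
rewrite !scalerA -!signr_addb !mulgA; congr ((-1) ^+ (nat_of_bool _) *: _).
by rewrite !odd_permM; do 4 case: odd_perm.
Qed.

End NestedArcs.

(** * The left-hand side: straightening cups and caps *)

Definition node_cast k l k' l' (e : (k = k') * (l = l')) (x : 'I_k + 'I_l) :
    'I_k' + 'I_l' :=
  match x with
  | inl a => inl (cast_ord e.1 a)
  | inr b => inr (cast_ord e.2 b)
  end.

Lemma bcast_bvec (K : fieldType) (delta : K) k l k' l'
    (e : (k = k') * (l = l')) (D : bdiag k l) :
  exists2 D' : bdiag k' l', bcast e (bvec delta D) = bvec delta D' &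
    forall x, D' (node_cast e x) = node_cast e (D x).
Proof.
case: e => ek el; case: _ / ek; case: _ / el; exists D => // x.
have castE y : node_cast (erefl k, erefl l) y = y.
  by case: y => a /=; rewrite cast_ord_id.
by rewrite !castE.
Qed.

Section Arcs.
Variables (k l k' l' : nat) (D : bdiag k l) (D' : bdiag k' l').

Lemma tens_left x : bd_tens D D' (bd_left k' l' x) = bd_left k' l' (D x).
Proof. by rewrite mk_bdiagE bd_tens_left. Qed.

Lemma tens_right x : bd_tens D D' (bd_right k l x) = bd_right k l (D' x).
Proof. by rewrite mk_bdiagE bd_tens_right. Qed.

End Arcs.

Section Through.
Variables (k l n : nat) (D : bdiag l n) (S : bdiag k l).

Lemma comp_arc_up v w u :
  S (inl v) = inr w -> D (inl w) = inr u -> bd_comp D S (inl v) = inr u.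
Proof.
move=> Sv Dw; apply: bd_compE => //=.
have := connect_dn D S (inl v); rewrite Sv => /connect_trans; apply.
by have := connect_up D S (inl w); rewrite Dw.
Qed.

Lemma comp_arc_turn v w w' v' :
    S (inl v) = inr w -> D (inl w) = inl w' -> S (inl v') = inr w' ->
  bd_comp D S (inl v) = inl v'.
Proof.
move=> Sv Dw Sv'; apply: bd_compE => /=.
  apply/eqP => -[vv']; have := bd_neq D (inl w); rewrite Dw.
  by move: Sv; rewrite -vv' Sv' => -[->]; rewrite eqxx.
have := connect_dn D S (inl v); rewrite Sv => /connect_trans; apply.
have := connect_up D S (inl w); rewrite Dw => /connect_trans; apply.
by have := connect_dn D S (inl v'); rewrite Sv' glue_connect_sym.
Qed.

Lemma bcomp_through (K : fieldType) (delta : K) :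
  (forall j, exists v, S (inr j) = inl v) ->
  bvec delta D \oB bvec delta S = bvec delta (bd_comp D S).
Proof.
move=> out; rewrite bcomp_bvec bd_loops0 ?scale1r // => j.
have [v Sj] := out j; exists (inl v).
by have := connect_dn D S (inr j); rewrite Sj.
Qed.

End Through.

Section Reversal.
Variables m i : nat.
Local Notation n := m.+1.

Definition rev_right (c : 'I_n) : 'I_n :=
  if (c < i)%N then c else inord (i + m - c).

Lemma val_rev_right c :
  rev_right c = (if c < i then nat_of_ord c else i + m - c)%N :> nat.
Proof.
rewrite /rev_right; case: ifP => // ci.
by rewrite inordK //; have := ltn_ord c; lia.
Qed.

Lemma rev_rightK : involutive rev_right.
Proof.
move=> c; apply: val_inj; rewrite /= !val_rev_right.
have := ltn_ord c; case: (ltnP c i) => [->|ci ltc] //.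
by case: ltnP; lia.
Qed.

Definition rev_perm : 'S_n := perm (inv_inj rev_rightK).

Lemma val_rev_perm c :
  rev_perm c = (if c < i then nat_of_ord c else i + m - c)%N :> nat.
Proof. by rewrite permE val_rev_right. Qed.

End Reversal.

Section CapCup.
Variables (K : fieldType) (m i p : nat).
Local Notation n := m.+1.
Local Notation M := (n + (p + p))%N.
Hypotheses (e_mid : (i + p.*2 + p = M)%N) (e_out : (i + 0 + p = n)%N).
Variable delta : K.
Local Notation rev_perm := (rev_perm m i).

Section Cup.
Variable cup : bdiag n M.
Hypothesis cupE : forall x, cup (node_cast (e_out, e_mid) x) =
  node_cast (e_out, e_mid) (bd_tens (bd_tens (bd_id i) (bd_cup p)) (bd_id p) x).

Lemma cup_left (x : 'I_n) (v : 'I_M) :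
  (x < i)%N -> v = x :> nat -> cup (inl x) = inr v.
Proof.
move=> xi vx; pose a := Ordinal xi.
have -> : inl x =
    node_cast (e_out, e_mid) (bd_left p p (bd_left 0 p.*2 (inl a))).
  by congr inl; apply: val_inj.
rewrite cupE !tens_left mk_bdiagE; congr inr; apply: val_inj => /=.
by rewrite vx.
Qed.

Lemma cup_right (x : 'I_n) (v : 'I_M) :
  (i <= x)%N -> v = (x + p.*2)%N :> nat -> cup (inl x) = inr v.
Proof.
move=> ix vx; have xp : (x - i < p)%N by have := ltn_ord x; lia.
pose a := Ordinal xp.
have -> : inl x =
    node_cast (e_out, e_mid) (bd_right (i + 0) (i + p.*2) (inl a)).
  by congr inl; apply: val_inj => /=; lia.
rewrite cupE tens_right mk_bdiagE; congr inr; apply: val_inj => /=.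
by rewrite vx; lia.
Qed.

Lemma cup_mid (v w : 'I_M) :
    (i <= v < i + p.*2)%N -> (v + w).+1 = (i + i + p.*2)%N ->
  cup (inr v) = inr w.
Proof.
move=> vi vw; have vp : (v - i < p.*2)%N by lia.
pose a := Ordinal vp.
have -> : inr v =
    node_cast (e_out, e_mid) (bd_left p p (bd_right i i (inr a))).
  by congr inr; apply: val_inj => /=; lia.
rewrite cupE tens_left tens_right mk_bdiagE; congr inr; apply: val_inj => /=.
by lia.
Qed.

End Cup.

Section Cap.
Variable cap : bdiag M n.
Hypothesis capE : forall x, cap (node_cast (e_mid, e_out) x) =
  node_cast (e_mid, e_out) (bd_tens (bd_tens (bd_id i) (bd_cap p)) (bd_id p) x).

Lemma cap_left (x : 'I_n) (v : 'I_M) :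
  (x < i)%N -> v = x :> nat -> cap (inl v) = inr x.
Proof.
move=> xi vx; pose a := Ordinal xi.
have -> : inl v =
    node_cast (e_mid, e_out) (bd_left p p (bd_left p.*2 0 (inl a))).
  by congr inl; apply: val_inj.
rewrite capE !tens_left mk_bdiagE; congr inr; exact: val_inj.
Qed.

Lemma cap_right (x : 'I_n) (v : 'I_M) :
  (i <= x)%N -> v = (x + p.*2)%N :> nat -> cap (inl v) = inr x.
Proof.
move=> ix vx; have xp : (x - i < p)%N by have := ltn_ord x; lia.
pose a := Ordinal xp.
have -> : inl v =
    node_cast (e_mid, e_out) (bd_right (i + p.*2) (i + 0) (inl a)).
  by congr inl; apply: val_inj => /=; lia.
rewrite capE tens_right mk_bdiagE; congr inr; apply: val_inj => /=.
by lia.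
Qed.

Lemma cap_mid (v w : 'I_M) :
    (i <= v < i + p.*2)%N -> (v + w).+1 = (i + i + p.*2)%N ->
  cap (inl v) = inl w.
Proof.
move=> vi vw; have vp : (v - i < p.*2)%N by lia.
pose a := Ordinal vp.
have -> : inl v =
    node_cast (e_mid, e_out) (bd_left p p (bd_right i i (inl a))).
  by congr inl; apply: val_inj => /=; lia.
rewrite capE tens_left tens_right mk_bdiagE; congr inl; apply: val_inj => /=.
by lia.
Qed.

End Cap.

Section Middle.
Variable s : 'S_n.
Local Notation mid := (bd_tens (bd_perm s) (bd_swap p p)).

Lemma mid_left (x : 'I_n) (v w : 'I_M) :
  v = x :> nat -> w = s x :> nat -> mid (inl v) = inr w.
Proof.
move=> vx wx; have -> : inl v = bd_left (p + p) (p + p) (inl x : 'I_n + 'I_n).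
  by congr inl; apply: val_inj.
by rewrite tens_left bd_perm_inl; congr inr; apply: val_inj.
Qed.

Lemma mid_right (v w : 'I_M) :
    (n <= v)%N -> (n <= w)%N -> (w = v + p :> nat)%N \/ (v = w + p :> nat)%N ->
  mid (inl v) = inr w.
Proof.
move=> nv nw vw; have vp : (v - n < p + p)%N by have := ltn_ord v; lia.
have -> : inl v = bd_right n n (inl (Ordinal vp) : _ + 'I_(p + p)).
  by congr inl; apply: val_inj => /=; lia.
rewrite tens_right mk_bdiagE /=; congr inr; apply: val_inj => /=.
by rewrite /swap_ord; case: splitP => j /= vj; have := ltn_ord j;
   have := ltn_ord w; lia.
Qed.

Lemma mid_inr (w : 'I_M) : exists v, mid (inr w) = inl v.
Proof.
case: (bd_tens_cases (inr w : 'I_M + 'I_M)) => -[[j|j] // ->].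
  by rewrite tens_left mk_bdiagE /=; eexists.
by rewrite tens_right mk_bdiagE /=; eexists.
Qed.

End Middle.

(** Input [x] of [s] is joined to the lower outer node [x] when it is left of
    the wall; otherwise a cup sends it through the swap to an upper outer node, in
    the column obtained by reversing the right-hand side.  The outputs behave in
    the same way with the two rows exchanged. *)
Lemma cap_mid_cup s :
  bcast (e_mid, e_out) (bI delta i \otB bA delta p \otB bI delta p)
  \oB (bvec delta (bd_perm s) \otB bX delta p p)
  \oB bcast (e_out, e_mid) (bI delta i \otB bU delta p \otB bI delta p) =
  bvec delta (ptransp (wall m i) (rev_perm * s * rev_perm)).
Proof.
rewrite /bI /bA /bU /bX !btens_bvec.
have [cap -> capE] := bcast_bvec delta (e_mid, e_out)
  (bd_tens (bd_tens (bd_id i) (bd_cap p)) (bd_id p)).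
have [cup -> cupE] := bcast_bvec delta (e_out, e_mid)
  (bd_tens (bd_tens (bd_id i) (bd_cup p)) (bd_id p)).
rewrite bcomp_through; last exact: mid_inr.
set top := bd_comp _ _; pose G := glue top cup.
pose node (x : 'I_n) : 'I_n + 'I_M + 'I_n := inl (inr (lshift (p + p) x)).
(* where the inputs and the outputs of the permutation lead *)
have foot x : connect G (node x) (outer M (flip (wall m i) (inl (rev_perm x)))).
  have rx := val_rev_perm i x; have ltx := ltn_ord x.
  rewrite /= inE; case: ifP => rxi.
    have := connect_dn top cup (inl (rev_perm x)).
    rewrite (cup_left cupE (v := lshift (p + p) x)) //; last first.
      by move: rxi; rewrite rx /=; case: ifP => //; lia.
    by rewrite glue_connect_sym.
  have ltv : (i + i + p.*2 - x.+1 < M)%N.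
    by move: rxi; rewrite rx; case: ifP; lia.
  pose v := Ordinal ltv.
  apply: (@connect_trans _ _ (inl (inr v))).
    have := connect_dn top cup (inr (lshift (p + p) x)).
    by rewrite (cup_mid cupE (w := v)) //=;
      move: rxi; rewrite rx; case: ifP; lia.
  have := connect_up top cup (inl v).
  have ltw : (v + p < M)%N by move: rxi; rewrite rx /=; case: ifP; lia.
  rewrite (@comp_arc_up _ _ _ _ _ v (Ordinal ltw) (rev_perm x)) //.
    apply: mid_right => /=; [| |by left].
      by move: rxi; rewrite rx; case: ifP; lia.
    by move: rxi; rewrite rx; case: ifP; lia.
  by apply: (cap_right capE) => /=; move: rxi; rewrite rx; case: ifP; lia.
have head x :
    connect G (node x) (outer M (flip (wall m i) (inr (rev_perm (s x))))).
  have rx := val_rev_perm i (s x); have ltx := ltn_ord (s x).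
  have upx := connect_up top cup (inl (lshift (p + p) x)).
  rewrite /= inE; case: ifP => rxi.
    move: upx.
    rewrite (@comp_arc_up _ _ _ _ _ _ (lshift (p + p) (s x)) (rev_perm (s x))) //.
      exact: (@mid_left _ x).
    by apply: (cap_left capE) => //=;
      move: rxi; rewrite rx /=; case: ifP => //; lia.
  have ltw : (i + i + p.*2 - (s x).+1 < M)%N.
    by move: rxi; rewrite rx; case: ifP; lia.
  have ltv : (rev_perm (s x) + p.*2 < M)%N.
    by move: rxi; rewrite rx; case: ifP; lia.
  pose w := Ordinal ltw; pose v := Ordinal ltv.
  have topE : top (inl (lshift (p + p) x)) = inl v.
    apply: (@comp_arc_turn _ _ _ _ _ _ (lshift (p + p) (s x)) w).
    - exact: (@mid_left _ x).
    - by apply: (cap_mid capE) => /=; move: rxi; rewrite rx; case: ifP; lia.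
    - by apply: mid_right => /=; move: rxi; rewrite rx; case: ifP; lia.
  rewrite topE in upx; apply: connect_trans upx _.
  have := connect_dn top cup (inl (rev_perm (s x))).
  rewrite (cup_right cupE (v := v)) //; first by rewrite glue_connect_sym.
  by lia.
apply: bcomp_pt_eq => [j|c].
  (* inputs of the permutation, then inputs of the swap coming from the cup,
     then those coming from the lower row *)
  have [ltj|lej] := ltnP j n.
    exists (flip (wall m i) (inl (rev_perm (Ordinal ltj)))).
    have := foot (Ordinal ltj); rewrite /node.
    by rewrite (_ : lshift _ _ = j) //; apply: val_inj.
  have [ltjp|lejp] := ltnP j (n + p).
    have ltx : (i + i + p.*2 - j.+1 < n)%N by lia.
    exists (flip (wall m i) (inl (rev_perm (Ordinal ltx)))).
    apply: connect_trans (foot _); have := connect_dn top cup (inr j).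
    by rewrite (cup_mid cupE (w := lshift (p + p) (Ordinal ltx))) //=; lia.
  have ltx : (j - p.*2 < n)%N by have := ltn_ord j; lia.
  exists (inl (Ordinal ltx)); have := connect_dn top cup (inl (Ordinal ltx)).
  rewrite (cup_right cupE (v := j)) /=; [by rewrite glue_connect_sym | lia | lia].
rewrite !permM; set x := rev_perm c.
have -> : c = rev_perm x by rewrite /x !permE rev_rightK.
apply: connect_trans (head x); rewrite glue_connect_sym; exact: foot.
Qed.

End CapCup.

(** * The two sides compared *)

Lemma E_eltE (K : fieldType) m (i : 'I_m.+2) :
  E_elt K i =
  \sum_(s : 'S_m.+1) (-1) ^+ s *: bvec (m%:R : K) (ptransp (wall m i) s).
Proof.
rewrite /E_elt /Sigma_plus btens_suml bcomp_sumr bcomp_suml.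
set w := rev_perm m i.
have wK : (w * w = 1)%g by apply/permP => c; rewrite permM !permE rev_rightK.
have wi : injective (fun s : 'S_m.+1 => w * s * w)%g.
  by move=> s t /mulIg /mulgI.
rewrite [RHS](reindex_inj wi); apply: eq_bigr => s _.
by rewrite cap_mid_cup !odd_permM addbC addbA addbb.
Qed.

Section Coefficients.
Variables (K : fieldType) (charK : [pchar K] =i pred0) (m : nat) (i : 'I_m.+2).
Local Notation L := (wall m i).

Lemma card_wall : #|L| = i.
Proof.
rewrite (_ : L = [set x : 'I_m.+1 | (0 <= x < i)%N]).
  by rewrite card_ord_interval ?subn0 // -ltnS.
by apply/setP => x; rewrite !inE.
Qed.

Lemma card_wallC : #|~: L| = (m.+1 - i)%N.
Proof. by have := cardsC L; rewrite card_wall card_ord; lia. Qed.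

(** Only the index [j] counting the points that [s] carries from left to right
    of the wall contributes. *)
Lemma sum_coef_factoring (s : 'S_m.+1) :
  \sum_(0 <= j < (minn i (m.+1 - i)).+1)
    c_coef K m i j *+ #|factoring L (nest m i 0 j) s| = 1.
Proof.
have := crossings_le L s; rewrite card_wall card_wallC => le_s.
have lti := ltn_ord i.
rewrite (big_cat_nat (leq0n (crossings L s))) /=; last lia.
rewrite big_nat big1 ?add0r => [|j lt_j]; last first.
  rewrite card_factoring crossings_nest; [|lia..].
  by case: eqP; [lia | rewrite mulr0n].
rewrite big_ltn ?ltnS // big_nat big1 ?addr0 => [|j lt_j]; last first.
  rewrite card_factoring crossings_nest; [|lia..].
  by case: eqP; [lia | rewrite mulr0n].
rewrite card_factoring crossings_nest; [|lia..].
rewrite eqxx card_wall card_wallC /c_coef -[LHS]mulr_natr mulVf //.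
have /pcharf0P -> := charK; rewrite -lt0n.
by rewrite !muln_gt0 !fact_gt0.
Qed.

End Coefficients.

Lemma sign_permM (K : fieldType) n (s t : 'S_n) :
  (-1) ^+ (s * t)%g = (-1) ^+ s * (-1) ^+ t :> K.
Proof. by rewrite odd_permM signr_addb. Qed.

Theorem lemma6p7 (K : fieldType) (charK : [pchar K] =i pred0)
    (m : nat) (m_ge1 : (1 <= m)%N) (i : 'I_m.+2) :
  E_elt K i =
  \sum_(0 <= j < (minn i (m.+1 - i)).+1)
    (-1) ^+ j *: (c_coef K m i j *: Xi_elt K m i j).
Proof.
have lti := ltn_ord i; rewrite E_eltE.
pose v (s : 'S_m.+1) := (-1) ^+ s *: bvec (m%:R : K) (ptransp (wall m i) s).
transitivity (\sum_(0 <= j < (minn i (m.+1 - i)).+1)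
    \sum_s (c_coef K m i j *+ #|factoring (wall m i) (nest m i 0 j) s|) *: v s).
  rewrite exchange_big; apply: eq_bigr => s _.
  by rewrite -scaler_suml sum_coef_factoring // scale1r.
apply: eq_big_nat => j lt_j; have le_ji : (j <= i)%N by lia.
have le_n : (i + j <= m.+1)%N by lia.
rewrite /Xi_elt e_eltE // F_pt_F scalerA mulrC -scalerA.
rewrite (_ : \sum_s _ = c_coef K m i j *:
    \sum_s v s *+ #|factoring (wall m i) (nest m i 0 j) s|); last first.
  by rewrite scaler_sumr; apply: eq_bigr => s _; rewrite -scalerMnl scalerMnr.
congr (_ *: _); rewrite -sum_double_coset scaler_sumr; apply: eq_bigr => h _.
rewrite scaler_sumr; apply: eq_bigr => h' _; rewrite /v !scalerA; congr (_ *: _).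
by rewrite !sign_permM odd_nest // signr_odd -!mulrA mulrCA.
Qed.
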